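(* Let $\mathcal{H}$ be an infinite-dimensional separable real Hilbert space with unit sphere $\mathcal{S} = \{x \in \mathcal{H} : \|x\| = 1\}$. Let $\nu$ be a probability measure on $\mathcal{S}$ and let $U = \overline{\mathrm{span}}\{\mathrm{supp}(\nu)\}$ be the closed linear span of the support of $\nu$. Suppose that $\dim(U^\perp) \geq 1$. Then: (1) For any continuous function $\phi : [0,\pi] \to \mathbb{R}$, there exists $s^* \in \mathcal{S}$ such that $$F_\phi(s^* ) = \inf_{s \in \mathcal{S}} F_\phi(s), \qquad \text{where } F_\phi(s) = \int_{\mathcal{S}} \phi\{d_{\mathcal{S}}(s,x)\}\, \mathrm{d}\nu(x), \quad s \in \mathcal{S}.$$ Moreover, if such an $s^*$ is unique, then $s^* \in U \cap \mathcal{S}$. (2) In particular, for any real $p > 0$, an $L^p$ centre of mass of $\nu$ exists, i.e. a minimiser over $s \in \mathcal{S}$ of $F_p(s) = \int_{\mathcal{S}} d_{\mathcal{S}}(s,x)^p \, \mathrm{d}\nu(x)$. (3) The result also holds for $L^\infty$ centres of mass: there exists $s^* \in \mathcal{S}$ minimising $$F_\infty(s) = \sup_{x \in \overline{\mathrm{supp}(\nu)}} d_{\mathcal{S}}(s,x), \qquad s \in \mathcal{S},$$ over $\mathcal{S}$, and if such a minimiser $s^*$ is unique, then $s^* \in U \cap \mathcal{S}$.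
   Context: The inner product and norm of $\mathcal{H}$ are $\langle \cdot,\cdot\rangle$ and $\|\cdot\| = \langle\cdot,\cdot\rangle^{1/2}$. The sphere $\mathcal{S}$ carries the great-arc distance $d_{\mathcal{S}}(x,x') = \arccos(\langle x,x'\rangle) \in [0,\pi]$. Probability measures on $\mathcal{S}$ are Borel. $U^\perp$ denotes the orthogonal complement of $U$ in $\mathcal{H}$. *)

(* Defs.v *)
From HB Require Import structures.
From mathcomp Require Import all_boot all_order all_algebra.
From mathcomp Require Import all_classical all_reals all_analysis.

Set Implicit Arguments.
Unset Strict Implicit.
Unset Printing Implicit Defensive.

Import Order.TTheory GRing.Theory Num.Theory.
Import numFieldNormedType.Exports.

Local Open Scope classical_set_scope.
Local Open Scope ring_scope.

Definition separable (T : topologicalType) : Prop :=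
  exists2 D : set T, countable D & dense D.

Section linear_algebra.
Context {R : realType} {H : normedModType R}.
Implicit Types (A V : set H).

Definition linearly_independent (n : nat) (v : 'I_n -> H) : Prop :=
  forall a : 'I_n -> R, \sum_(i < n) a i *: v i = 0 -> forall i, a i = 0.

(* The algebraic dimension of V, possibly infinite, is at least n. *)
Definition dim_ge (n : nat) V : Prop :=
  exists2 v : 'I_n -> H, forall i, V (v i) & linearly_independent v.

Definition linear_span A : set H :=
  [set y | exists (n : nat) (a : 'I_n -> R) (x : 'I_n -> H),
     (forall i, A (x i)) /\ y = \sum_(i < n) a i *: x i].

Definition closed_span A : set H := closure (linear_span A).

Definition orthogonal_complement (dot : {dot H for idfun}) V : set H :=
  [set y | forall x, V x -> dot x y = 0].

End linear_algebra.

Definition infinite_dimensional {R : realType} (H : normedModType R) : Prop :=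
  forall n : nat, dim_ge n [set: H].

Definition unit_vectors {R : realType} (H : normedModType R) : set H :=
  [set x | `|x| = 1].
Arguments unit_vectors {R} H.

(* Measurable types are pointed, so the type of unit vectors can carry its
   Borel sigma-algebra only given a witness that the space is nonzero; this is
   the only role of the proof hinf. The topology is the one induced by H. *)
Definition sphere {R : realType} {H : normedModType R}
  (hinf : infinite_dimensional H) : Type := set_type (unit_vectors H).

Section sphere_instances.
Context {R : realType} {H : normedModType R} (hinf : infinite_dimensional H).

Lemma unit_vectors_nonempty : exists x : H, x \in unit_vectors H.
Proof.
have [v _ vfree] := hinf 1; have v0 : v ord0 != 0.
  apply/eqP => v0; have := vfree (fun=> 1).
  rewrite big_ord1 v0 scaler0 => /(_ erefl ord0) /eqP.
  by rewrite oner_eq0.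
exists (`|v ord0|^-1 *: v ord0); rewrite inE /unit_vectors /=.
by rewrite normrZ normfV normr_id mulVf// normr_eq0.
Qed.

HB.instance Definition _ := Topological.copy (sphere hinf)
  (set_type (unit_vectors H)).
Definition sphere_point : sphere hinf :=
  exist _ (projT1 (cid unit_vectors_nonempty))
    (projT2 (cid unit_vectors_nonempty)).
HB.instance Definition _ := isPointed.Build (sphere hinf) sphere_point.

End sphere_instances.


Definition sphere_val {R : realType} {H : normedModType R}
  {hinf : infinite_dimensional H} (s : sphere hinf) : H := set_val s.

Notation borelType T := (@g_sigma_algebraType T open).

Definition support {R : realType} {T : ptopologicalType}
  (nu : probability (borelType T) R) : set T :=
  [set x | forall V : set T, open V -> V x -> (0 < nu V)%E].

Section centres_of_mass.
Context {R : realType} {H : completeNormedModType R}.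
Context {hinf : infinite_dimensional H}.
Variables (dot : {dot H for idfun}) (nu : probability (borelType (sphere hinf)) R).
Implicit Types (s x : sphere hinf).

Definition dist_sphere s x : R := acos (dot (sphere_val s) (sphere_val x)).

Definition support_span : set H := closed_span (sphere_val @` support nu).

(* The objective functions take values in \bar R, where infima and suprema of
   arbitrary sets are meaningful. *)
Definition F_phi (phi : R -> R) s : \bar R :=
  (\int[nu]_x (phi (dist_sphere s x))%:E)%E.

Definition F_p (p : R) s : \bar R :=
  (\int[nu]_x (dist_sphere s x `^ p)%:E)%E.

Definition F_infty s : \bar R :=
  ereal_sup [set (dist_sphere s x)%:E | x in closure (support nu)].

End centres_of_mass.

Definition minimizer {R : realType} {T : Type} (F : T -> \bar R) (s : T) : Prop :=
  F s = ereal_inf (range F).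

(* Main.v *)
(* Let U be the closed span of the support and e a nonzero vector orthogonal
   to U. Each objective F depends on s only through the numbers <s, x> for x
   in U, and is sequentially lower semicontinuous for their pointwise
   convergence: by dominated convergence for F_phi, as a supremum of continuous
   functions for F_infty. A minimising sequence has a subsequence converging
   weakly to some w in the unit ball; moving w along e restores norm 1 without
   changing <w, x> for x in U, so the resulting point is a minimiser. If s is a
   minimiser and p its projection on U, then so is the reflection 2p - s;
   uniqueness forces s = p. *)

Require Import Defs.
From HB Require Import structures.
From mathcomp Require Import all_boot all_order all_algebra.
From mathcomp Require Import all_classical all_reals all_analysis.
From mathcomp Require Import measurable_realfun ring lra.
Import Order.TTheory GRing.Theory Num.Theory.
Import numFieldNormedType.Exports.
Local Open Scope classical_set_scope.
Local Open Scope ring_scope.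

(** * Inner product algebra and the Cauchy-Schwarz inequality *)

Section inner_product.
Context {R : realType} {H : completeNormedModType R} (dot : {dot H for idfun}).
Hypothesis dot_norm : forall x : H, `|x| = Num.sqrt (dot x x).
Implicit Types x y z : H.

Lemma dotC x y : dot x y = dot y x.
Proof. by rewrite hermC expr0 mul1r. Qed.

Lemma dotDl x y z : dot (x + y) z = dot x z + dot y z.
Proof. exact: linearDl. Qed.

Lemma dotZl (a : R) x y : dot (a *: x) y = a * dot x y.
Proof. exact: linearZl_LR. Qed.

Lemma dotNl x y : dot (- x) y = - dot x y.
Proof. exact: linearNl. Qed.

Lemma dotDr x y z : dot z (x + y) = dot z x + dot z y.
Proof. by rewrite dotC dotDl !(dotC z). Qed.

Lemma dotZr (a : R) x y : dot y (a *: x) = a * dot y x.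
Proof. by rewrite dotC dotZl (dotC y). Qed.

Lemma dotNr x y : dot x (- y) = - dot x y.
Proof. by rewrite dotC dotNl (dotC x). Qed.

Lemma dotxx x : dot x x = `|x| ^+ 2.
Proof.
rewrite dot_norm sqr_sqrtr//; have [->|x0] := eqVneq x 0.
  by rewrite linear0l.
by apply/ltW; have /(_ _ x0) := @neq0_dnorm_gt0 _ _ _ dot.
Qed.

Lemma normD_sqr x y : `|x + y| ^+ 2 = `|x| ^+ 2 + 2 * dot x y + `|y| ^+ 2.
Proof. by rewrite -!dotxx dotDl !dotDr (dotC y x); ring. Qed.

Lemma normB_sqr x y : `|x - y| ^+ 2 = `|x| ^+ 2 - 2 * dot x y + `|y| ^+ 2.
Proof. by rewrite normD_sqr normrN dotNr; ring. Qed.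

(** Expand the squared norm of |y|^2 x - <x, y> y, a multiple of the part of [x] orthogonal to [y];
    the scaling by |y|^2 avoids division. *)
Lemma dot_le_norm x y : `|dot x y| <= `|x| * `|y|.
Proof.
have [->|y0] := eqVneq y 0.
  by rewrite linear0r !normr0 mulr0.
have ny : 0 < `|y| by rewrite normr_gt0.
rewrite -(@ler_pXn2r _ 2) ?nnegrE ?mulr_ge0// real_normK ?num_real//.
rewrite exprMn -(@ler_pM2r _ (`|y| ^+ 2)) ?exprn_gt0//.
have := sqr_ge0 `| (`|y| ^+ 2) *: x - dot x y *: y |.
rewrite normB_sqr dotZl dotZr !normrZ !exprMn.
rewrite !real_normK ?num_real ?exprn_even_ge0//.
set d := dot x y; set a := `|x|; set b := `|y| => h.
have -> : d ^+ 2 * b ^+ 2 = a ^+ 2 * b ^+ 2 * b ^+ 2 -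
   ((b ^+ 2) ^+ 2 * a ^+ 2 - 2 * (b ^+ 2 * (d * d)) + d ^+ 2 * b ^+ 2).
  by ring.
by lra.
Qed.

Lemma dot_continuous x : continuous (dot x).
Proof.
move=> y; apply/cvgrPdist_le => e e0; near=> z.
rewrite -dotNr -dotDr (le_trans (dot_le_norm _ _))//.
have x1 : 0 < `|x| + 1 by rewrite ltr_wpDl.
rewrite (@le_trans _ _ ((`|x| + 1) * `|y - z|)) ?ler_wpM2r ?lerDl//.
rewrite mulrC -ler_pdivlMr//; near: z.
by apply: cvgr_dist_le; [exact: cvg_id|rewrite divr_gt0].
Unshelve. all: by end_near. Qed.

End inner_product.

(** * Riesz representation on closed subspaces *)

Section riesz.
Context {R : realType} {H : completeNormedModType R} (dot : {dot H for idfun}).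
Hypothesis dot_norm : forall x : H, `|x| = Num.sqrt (dot x x).

(* The representing vector is the minimiser over V of |x|^2 - 2 l(x); minimising
   sequences are Cauchy by the parallelogram law. *)
Lemma riesz_representation (V : set H) (l : H -> R) (C : R) :
  scalar l ->
  V 0 -> (forall a x y, V x -> V y -> V (a *: x + y)) -> closed V ->
  (forall x, `|l x| <= C * `|x|) ->
  exists2 p, V p & forall x, V x -> l x = dot p x.
Proof.
move=> l_scalar V0 Vlin Vclosed LC.
have [L lL] : exists L : {scalar H}, l = L.
  by exists (HB.pack_for {scalar H} l (GRing.isLinear.Build _ _ _ _ l l_scalar)).
rewrite {l l_scalar}lL in LC *.
pose J x := `|x| ^+ 2 - 2 * L x.
(* Completing the square in |x|, since L(x) <= C |x|. *)
have Jlb x : - C ^+ 2 <= J x.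
  have h : L x <= C * `|x| by rewrite (le_trans (ler_norm _)).
  have := sqr_ge0 (`|x| - C); rewrite /J; nra.
have Jinf : has_inf (J @` V).
  by split; [exists (J 0), 0|exists (- C ^+ 2) => _ [x _ <-]].
set i := inf (J @` V).
have iJ x : V x -> i <= J x by move=> Vx; apply: ge_inf; [case: Jinf|exists x].
have /choice[u /all_and2[Vu uJ]] n : exists x, V x /\ J x < i + n.+1%:R^-1.
  have n0 : 0 < n.+1%:R^-1 :> R by rewrite invr_gt0.
  by have [_ [x Vx <-] ?] := inf_adherent n0 Jinf; exists x.
(* The midpoint m of x and y lies in [V], so J(m) >= i, and |x - y|^2 = 2 J(x) + 2 J(y) - 4 J(m). *)
have Jmid x y : V x -> V y -> `|x - y| ^+ 2 <= 2 * (J x + J y - 2 * i).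
  move=> Vx Vy.
  have Vm : V (2^-1 *: (x + y)).
    rewrite -[X in V X]addr0; apply: (Vlin) => //.
    by rewrite -[x]scale1r; exact: Vlin.
  have := iJ _ Vm; rewrite /J [L (_ *: _)]linearZ [L (_ + _)]linearD/= normrZ exprMn (normD_sqr _ dot_norm x y).
  by rewrite (normB_sqr _ dot_norm) real_normK ?num_real//; lra.
have /cauchy_cvgP/cvg_ex[p up] : cauchy (u @ \oo).
  apply: cauchy_exP => e e0.
  have e2 : 0 < e ^+ 2 / 4 by rewrite divr_gt0 ?exprn_gt0.
  have [N _ hN] : \forall n \near \oo, n.+1%:R^-1 < e ^+ 2 / 4 :> R.
    exact: near_infty_natSinv_lt (PosNum e2).
  exists (u N), N => // n Nn; rewrite -ball_normE /ball_ /=.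
  rewrite -(@ltr_pXn2r _ 2) ?nnegrE ?(ltW e0)//.
  rewrite (le_lt_trans (Jmid _ _ _ _))//.
  have hn k : (N <= k)%N -> J (u k) < i + e ^+ 2 / 4.
    by move=> Nk; rewrite (lt_trans (uJ k))// ltrD2l; exact: hN.
  by have := hn _ Nn; have := hn _ (leqnn N); lra.
have Vp : V p.
  by apply: (closed_cvg V) up => //; exact: nearW.
have Lcont : L (u n) @[n --> \oo] --> L p.
  apply/cvgrPdist_le => e e0; near=> n.
  rewrite -linearB (le_trans (LC _))//.
  have C1 : 0 < `|C| + 1 by rewrite ltr_wpDl.
  rewrite (@le_trans _ _ ((`|C| + 1) * `|p - u n|)) ?ler_wpM2r//.
    by rewrite (le_trans (ler_norm _))// lerDl.
  rewrite mulrC -ler_pdivlMr//; near: n.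
  by apply: cvgr_dist_le => //; rewrite divr_gt0.
have Jp : J p <= i.
  have Ju : J (u n) @[n --> \oo] --> J p.
    apply: cvgB; last by apply: cvgMr.
    under eq_fun do rewrite expr2.
    by rewrite expr2; apply: cvgM; apply: cvg_norm.
  have iu : i + n.+1%:R^-1 @[n --> \oo] --> i + 0.
    by apply: cvgD; [exact: cvg_cst|exact: cvg_harmonic].
  rewrite -[i]addr0 -(cvg_lim _ iu)// -(cvg_lim _ Ju)//.
  apply: ler_lim; [by apply/cvg_ex; eexists; exact: Ju|
    by apply/cvg_ex; eexists; exact: iu|].
  by apply: nearW => n; rewrite ltW.
exists p => // x Vx.
have [->|x0] := eqVneq x 0; first by rewrite linear0 linear0r.
have nx : 0 < `|x| ^+ 2 by rewrite exprn_gt0// normr_gt0.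
(* This [t] minimises [J] along the line p + t x. There [J] has dropped by t^2 |x|^2, so minimality
   of [p] forces this to vanish. *)
pose t := (L x - dot p x) / `|x| ^+ 2.
have := le_trans Jp (iJ (t *: x + p) (Vlin _ _ _ Vx Vp)).
rewrite /J [L (_ + _)]linearD [L (_ *: _)]linearZ/= (normD_sqr _ dot_norm)// normrZ exprMn dotZl (dotC _ x).
rewrite real_normK ?num_real// => h.
apply/eqP; rewrite -subr_eq0 -sqrf_eq0 -[_ == 0]orbF.
have tx : t * `|x| ^+ 2 = L x - dot p x by rewrite /t divfK// gt_eqF.
rewrite orbF eq_le sqr_ge0 andbT -tx exprMn.
suff : t ^+ 2 * `|x| ^+ 2 <= 0 by nra.
nra.
Unshelve. all: by end_near. Qed.

End riesz.

(** * Dense sequences and limits along ultrafilters *)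

Lemma countable_dense_sequence {T : ptopologicalType} : separable T ->
  exists d : nat -> T, forall O, open O -> O !=set0 -> exists n, O (d n).
Proof.
move=> [D Dcount Ddense].
have /pfcard_geP[D0|[d]] := Dcount.
  have [] := Ddense setT _ openT; first by exists point.
  by move=> x; rewrite D0 => -[].
exists d => O Oo On; have [x [Ox Dx]] := Ddense O On Oo.
have [n _ nx] := 'surj_d Dx.
by exists n; rewrite nx.
Qed.

(** A cluster point is already a limit: an ultrafilter contains the preimage of each neighbourhood
    or of its complement, and clustering excludes the latter. *)
Lemma ultra_compact_cvg {I : Type} {T : topologicalType} (G : set_system I)
    (f : I -> T) (K : set T) :
  UltraFilter G -> compact K -> (forall i, K (f i)) ->
  exists p : T, f i @[i --> G] --> p.
Proof.
move=> GU Kcomp Kf; have GP : ProperFilter G := @ultra_proper _ _ GU.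
have fGK : G (f @^-1` K) by apply: filterE => i; exact: Kf.
have [p [Kp pcl]] := Kcomp (f @ G) _ fGK.
exists p => A pA /=.
have [//|GnA] := in_ultra_setVsetC (f @^-1` A) GU.
by have [x [nAx Ax]] := pcl (~` A) A GnA pA.
Qed.

(** * Weak sequential compactness of the unit ball *)

Section weak_compactness.
Context {R : realType} {H : completeNormedModType R} (dot : {dot H for idfun}).
Hypothesis dot_norm : forall x : H, `|x| = Num.sqrt (dot x x).

(* The weak limit is found along an ultrafilter; the subsequence is then chosen
   to converge against a countable dense set. The indices k m are only required
   to be at least m, not to be increasing. *)
Lemma unit_ball_weak_sequentially_compact (s : nat -> H) :
  separable H -> (forall n, `|s n| <= 1) ->
  exists u (k : nat -> nat), [/\ `|u| <= 1, forall m, (m <= k m)%N &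
    forall x, dot (s (k m)) x @[m --> \oo] --> dot u x].
Proof.
move=> Hsep s1.
(* Along an ultrafilter finer than [\oo], the bounded sequences [dot (s n) x] converge for all [x]
   at once. *)
have [G [GU ooG]] := @ultraFilterLemma nat \oo _.
have GP : ProperFilter G := @ultra_proper _ _ GU.
have dot_s n x : `|dot (s n) x| <= 1 * `|x|.
  by rewrite (le_trans (dot_le_norm _ dot_norm _ _))// ler_wpM2r.
have /choice[L sL] x : exists p : R, dot (s n) x @[n --> G] --> p.
  apply: (@ultra_compact_cvg _ _ _ _ `[- `|x|, `|x|]%classic) => //.
    exact: segment_compact.
  by move=> n /=; rewrite in_itv/= -ler_norml -[leRHS]mul1r.
have LB x : `|L x| <= 1 * `|x|.
  apply: (closed_cvg (fun r : R => `|r| <= 1 * `|x|) _ _ _ (sL x)).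
    apply: (@closed_comp _ _ (Num.norm : R -> R) [set r | r <= 1 * `|x|]).
      by move=> r _; exact: norm_continuous.
    exact: closed_le.
  by apply: filterE.
(* The pointwise limit [L] is linear and bounded by the norm, hence represented by a vector [u]. *)
have [| |||u _ Lu] := @riesz_representation _ _ _ dot_norm setT L 1 _ I.
- move=> a x y; have sE : (fun n => dot (s n) (a *: x + y)) =
      (fun n => a * dot (s n) x + dot (s n) y).
    by apply/funext => n; rewrite dotDr dotZr.
  have := sL (a *: x + y); rewrite sE => /cvg_lim <- //.
  by apply: cvg_lim => //; apply: cvgD (sL y); apply: cvgMr.
- by [].
- exact: closedT.
- by [].
have u1 : `|u| <= 1.
  have [->|u0] := eqVneq u 0; first by rewrite normr0.
  have nu : 0 < `|u| by rewrite normr_gt0.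
  rewrite -(ler_pM2r nu) -expr2 -(dotxx _ dot_norm) -Lu//.
  by rewrite (le_trans (ler_norm _)).
have [d ddense] := countable_dense_sequence Hsep.
(* Each of these finitely many conditions holds on a member of [G], so some index satisfies them
   all. *)
have /choice[k /all_and2[mk kd]] m : exists k, (m <= k)%N /\
    forall i : 'I_m, `|dot u (d i) - dot (s k) (d i)| < m.+1%:R^-1.
  apply: (@filter_ex _ G); apply: filterI.
    by apply: ooG; exact: nbhs_infty_ge.
  apply: filter_forall => i; rewrite -Lu//.
  by have /cvgrPdist_lt := sL (d i); apply; rewrite invr_gt0.
exists u, k; split=> // x; apply/cvgrPdist_le => e e0.
have e4 : 0 < e / 4 by rewrite divr_gt0.
have [i xdi] : exists i, ball x (e / 4) (d i).
  by apply: ddense; [exact: ball_open|exists x; exact: ballxx].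
rewrite -ball_normE /ball_/= in xdi.
near=> m.
have mi : (i < m)%N by near: m; exact: nbhs_infty_gt.
have me : m.+1%:R^-1 < e / 4 by near: m; exact: near_infty_natSinv_lt (PosNum e4).
have := kd m (Ordinal mi) => /= kdm.
(* Replace [x] by the nearby [d i], which is tested at stage [m] because i < m; the norm bounds on
   [u] and [s (k m)] control the two errors. *)
have -> : dot u x - dot (s (k m)) x = (dot u (d i) - dot (s (k m)) (d i)) +
   (dot u (x - d i) - dot (s (k m)) (x - d i)).
  by rewrite !dotDr !dotNr; ring.
have hu : `|dot u (x - d i)| <= e / 4.
  rewrite (le_trans (dot_le_norm _ dot_norm _ _))//.
  by rewrite -[leRHS]mul1r ler_pM// ltW.
have hs : `|dot (s (k m)) (x - d i)| <= e / 4.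
  by rewrite (le_trans (dot_s _ _))// mul1r ltW.
rewrite (le_trans (ler_normD _ _))//.
rewrite (le_trans (lerD (ltW (lt_trans kdm me)) (ler_normB _ _)))//.
by rewrite (le_trans (lerD (lexx _) (lerD hu hs)))//; lra.
Unshelve. all: by end_near. Qed.

End weak_compactness.

(** * Continuity and measurability of the integrands *)

Section continuity.
Context {R : realType}.

(** Composition of limits for functions continuous only on an interval, such as [acos] and [phi]. *)
Lemma cvg_within_comp {I : Type} {T S : topologicalType} (A : set T)
    (g : T -> S) (F : set_system I) (f : I -> T) (c : T) :
  Filter F -> {within A, continuous g} -> A c -> (\forall i \near F, A (f i)) ->
  f i @[i --> F] --> c -> g (f i) @[i --> F] --> g c.
Proof.
move=> FF /subspace_continuousP gA Ac Af fc.
apply: cvg_comp (gA c Ac) => B /= cB.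
by apply: filterS2 Af (fc _ cB) => i Afi; apply.
Qed.

(** Obtained by inverting [cos] on [0, pi], so that the endpoints are covered: they correspond to
    equal and antipodal points of the sphere. *)
Lemma acos_within_continuous : {within `[-1, 1], continuous (@acos R)}.
Proof.
rewrite -cospi -[X in `[_, X]]cos0.
apply: segment_can_ge_continuous; first exact: pi_ge0.
  by apply: continuous_subspaceT; exact: continuous_cos.
exact: cosK.
Qed.

Lemma comp_acos_within_continuous (phi : R -> R) :
  {within `[0, pi], continuous phi} ->
  {within `[-1, 1], continuous (phi \o @acos R)}.
Proof.
have acos_itv (x : R) : x \in `[-1, 1] -> acos x \in `[0, pi].
  by rewrite !in_itv/= => x1; rewrite acos_ge0// acos_lepi.
move=> phi_cont; apply/subspace_continuousP => x x1.
apply: (@cvg_within_comp _ _ _ `[0, pi]%classic _ _ _ _ _ phi_cont).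
- exact: acos_itv.
- by apply: filterS (withinT _ _) => y; exact: acos_itv.
- by have /subspace_continuousP := acos_within_continuous; apply.
Qed.

Lemma powR_within_continuous (a p : R) : 0 < p ->
  {within `[0, a], continuous (fun x : R => x `^ p)}.
Proof.
move=> p0; apply/subspace_continuousP => x /=; rewrite in_itv/= => /andP[].
rewrite le_eqVlt => /predU1P[<- _|x0 _].
  (* At 0 the limit is one-sided; the value 0 at the point itself, due to p > 0, extends it to the
     closed half-line. *)
  have /cvg_at_right_within : x `^ p @[x --> 0^'+] --> (0 : R) `^ p.
    by rewrite powR0 ?gt_eqF//; exact: powR_cvg0.
  apply: cvg_trans; apply: cvg_app; apply: within_subset.
  by move=> y /=; rewrite in_itv => /andP[].
apply: cvg_within_filter; apply/differentiable_continuous/derivable1_diffP.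
by apply: derivable_powR; rewrite in_itv/= andbT.
Qed.

Lemma continuous_borel_measurable {T : ptopologicalType} (f : T -> R) :
  continuous f -> measurable_fun [set: borelType T] (f : borelType T -> R).
Proof.
move=> /continuousP cf; apply: (measurability _ (RGenOpens.measurableE R)).
move=> _ [_ [a [b ->] <-]]; rewrite setTI; apply: sub_sigma_algebra.
by apply: cf; exact: interval_open.
Qed.

End continuity.

(** Every point outside the support lies in a null open set, which can be shrunk to a basic one;
    there are only countably many of these. *)
Lemma negligible_setC_support {R : realType} {T : ptopologicalType}
    (nu : probability (borelType T) R) :
  @second_countable T -> nu.-negligible (~` Defs.support nu).
Proof.
move=> [B Bcount [Bopen Bbasis]].
pose N := [set V | B V /\ nu V = 0%E].
have cover x : (~` Defs.support nu) x -> exists2 U, N U & U x.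
  move=> /existsNP[V /not_implyP[Vo /not_implyP[Vx /negP]]].
  rewrite -leNgt => V0.
  have [U [BU Ux] UV] := Bbasis x V (open_nbhs_nbhs (conj Vo Vx)).
  exists U => //; split=> //; apply/eqP; rewrite eq_le measure_ge0 andbT.
  by apply: le_trans V0; apply: le_measure => //; rewrite inE;
    apply: sub_sigma_algebra => //; exact: Bopen.
have /pfcard_geP[N0|[f]] : countable N.
- by apply: sub_countable Bcount; apply: subset_card_le => V [].
- apply: (negligibleS _ (negligible_set0 nu)) => x /cover[U].
  by rewrite N0.
- have : nu.-negligible (\bigcup_n f n : set (borelType T)).
    apply: negligible_bigcup => n.
    have [Bn n0] : N (f n) by exact: funS.
    by apply/negligibleP => //; apply: sub_sigma_algebra; exact: Bopen.
  apply: negligibleS => x /cover[U NU Ux].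
  by have [n _ nU] := 'surj_f NU; exists n => //; rewrite nU.
Qed.

(** * The sphere and weakly lower semicontinuous functions *)

Section sphere.
Context {R : realType} {H : completeNormedModType R}.
Context {hinf : infinite_dimensional H}.
Variable dot : {dot H for idfun}.
Hypothesis dot_norm : forall x : H, `|x| = Num.sqrt (dot x x).
Implicit Types s x : sphere hinf.

Lemma norm_sphere_val s : `|sphere_val s| = 1.
Proof. by have := set_valP s. Qed.

Lemma sphere_val_continuous : continuous (sphere_val : sphere hinf -> H).
Proof. exact: initial_continuous. Qed.

(** The basis consists of traces of balls of [H] with centres in a dense sequence; the centres need
    not lie on the sphere. *)
Lemma sphere_second_countable : separable H -> @second_countable (sphere hinf).
Proof.
move=> /countable_dense_sequence[d ddense].
pose B (nm : nat * nat) : set (sphere hinf) :=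
  sphere_val @^-1` ball (d nm.1) nm.2.+1%:R^-1.
exists (range B); first by apply: sub_countable (card_image_le _ _) _.
split.
  move=> _ [[n m] _ <-] /=.
  have /continuousP := sphere_val_continuous; apply; exact: ball_open.
move=> x V; rewrite nbhsE => -[A [[W Wo <-] Wx] WV].
have /nbhs_ballP[e /= e0 eW] : nbhs (sphere_val x) W by exact: open_nbhs_nbhs.
have [m me] : exists m, m.+1%:R^-1 < e / 2.
  have e2 : 0 < e / 2 by rewrite divr_gt0.
  have [m _ /(_ m (leqnn m)) me] := near_infty_natSinv_lt (PosNum e2).
  by exists m.
have m0 : 0 < m.+1%:R^-1 :> R by rewrite invr_gt0.
have [n xn] : exists n, ball (sphere_val x) m.+1%:R^-1 (d n).
  by apply: ddense; [exact: ball_open|exists (sphere_val x); exact: ballxx].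
exists (B (n, m)); first by split; [exists (n, m)|exact: ball_sym].
move=> y yn; apply: WV; apply: eW; rewrite [e]splitr.
apply: ball_triangle (le_ball (ltW me) xn) (le_ball (ltW me) yn).
Qed.

Lemma dot_sphere_itv s x : dot (sphere_val s) (sphere_val x) \in `[-1, 1].
Proof.
rewrite in_itv/= -ler_norml (le_trans (dot_le_norm _ dot_norm _ _))//.
by rewrite !norm_sphere_val mulr1.
Qed.

Definition sphere_of_norm1 {x : H} (x1 : `|x| = 1) : sphere hinf :=
  exist _ x (mem_set (x1 : unit_vectors H x)).

(** Convergence is tested only against [U], so constant sequences show that [F] depends on a point
    only through its pairings with [U]. Convergent values suffice, as minimising sequences provide
    them. *)
Definition weakly_lower_semicontinuous (U : set H) (F : sphere hinf -> \bar R) :=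
  forall (s : nat -> sphere hinf) t (l : \bar R),
    (forall y, U y ->
      dot (sphere_val (s n)) y @[n --> \oo] --> dot (sphere_val t) y) ->
    F (s n) @[n --> \oo] --> l -> (F t <= l)%E.

Lemma weakly_lsc_has_minimizer (U : set H) (F : sphere hinf -> \bar R) :
  separable H -> dim_ge 1 (orthogonal_complement dot U) ->
  weakly_lower_semicontinuous U F -> exists s, minimizer F s.
Proof.
move=> Hsep [v vU vfree] Flsc.
pose e := v ord0.
have eU y : U y -> dot y e = 0 by exact: vU.
have e0 : e != 0.
  apply/eqP => e0; have := vfree (fun=> 1).
  by rewrite big_ord1 -/e e0 scaler0 => /(_ erefl ord0)/eqP; rewrite oner_eq0.
have [|f fF fl] := @ereal_inf_seq _ (range F).
  by apply/set0P; exists (F point), point.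
have /choice[s sF] n : exists x, F x = f n by have [x _ <-] := fF n; exists x.
have s1 n : `|sphere_val (s n)| <= 1 by rewrite norm_sphere_val.
have [w [k [w1 kle wk]]] := unit_ball_weak_sequentially_compact _ dot_norm
  (fun n => sphere_val (s n)) Hsep s1.
have [a wa1] : exists a : R, `|w + a *: e| = 1.
  (* The larger root of a quadratic equation, with a real root as |w| <= 1. *)
  have ne : 0 < `|e| ^+ 2 by rewrite exprn_gt0// normr_gt0.
  pose b := dot w e; pose d := b ^+ 2 + `|e| ^+ 2 * (1 - `|w| ^+ 2).
  have d0 : 0 <= d.
    rewrite addr_ge0 ?sqr_ge0// mulr_ge0 ?(ltW ne)// subr_ge0.
    by rewrite exprn_ile1.
  exists ((Num.sqrt d - b) / `|e| ^+ 2).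
  apply/eqP; rewrite -(@eqrXn2 _ 2)// expr1n (normD_sqr _ dot_norm).
  rewrite dotZr normrZ exprMn real_normK ?num_real// -/b.
  have dE := sqr_sqrtr d0.
  apply/eqP; move: dE; rewrite {2}/d; set q := Num.sqrt d.
  set n2 := `|e| ^+ 2 in ne *; set m2 := `|w| ^+ 2 => qE.
  have {}ne : n2 != 0 by rewrite gt_eqF.
  have -> : m2 + 2 * ((q - b) / n2 * b) + ((q - b) / n2) ^+ 2 * n2 =
     m2 + (q ^+ 2 - b ^+ 2) / n2 by field.
  by rewrite qE; field.
exists (sphere_of_norm1 wa1); apply/eqP; rewrite eq_le; apply/andP; split.
  apply: (Flsc (s \o k)) => [y Uy|].
    rewrite [sphere_val (sphere_of_norm1 _)]/= dotDl dotZl (dotC _ e).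
    by rewrite eU// mulr0 addr0; exact: wk.
  (* The bound m <= k m alone gives this, without monotonicity of [k]. *)
  have koo : k m @[m --> \oo] --> \oo.
    move=> A [N _ NA]; exists N => // m Nm; apply: NA => /=.
    exact: leq_trans Nm (kle m).
  under eq_fun do rewrite /= sF.
  exact: cvg_comp koo fl.
by apply: ereal_inf_lbound; exists (sphere_of_norm1 wa1).
Qed.

Lemma weakly_lsc_unique_minimizer (U : set H) (F : sphere hinf -> \bar R) s :
  U 0 -> (forall a (x y : H), U x -> U y -> U (a *: x + y)) -> closed U ->
  weakly_lower_semicontinuous U F -> unique (minimizer F) s ->
  U (sphere_val s).
Proof.
move=> U0 Ulin Uclosed Flsc [Fs Funiq].
pose z := sphere_val s.
(* The representative in [U] of pairing with [z] is the orthogonal projection of [z] on [U]. *)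
have [| |p Up zp] := @riesz_representation _ _ _ dot_norm U (dot z) `|z| _ U0 Ulin Uclosed.
- by move=> a x y; rewrite dotDr dotZr.
- by move=> x; exact: dot_le_norm.
(* The reflection of [z] across [U] keeps norm 1 because <z, p> = |p|^2. *)
have r1 : `|2 *: p - z| = 1.
  apply/eqP; rewrite -(@eqrXn2 _ 2)// expr1n (normB_sqr _ dot_norm).
  rewrite dotZl normrZ exprMn real_normK ?num_real// -(dotxx _ dot_norm p).
  rewrite -zp// (dotC _ z) norm_sphere_val; apply/eqP; ring.
have Fr : minimizer F (sphere_of_norm1 r1).
  apply/eqP; rewrite eq_le; apply/andP; split; last first.
    by apply: ereal_inf_lbound; exists (sphere_of_norm1 r1).
  (* The reflection and [s] have equal pairings with [U], so semicontinuity along the constant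
     sequence [s] compares their values. *)
  rewrite -Fs; apply: (Flsc (fun=> s)) => [y Uy|]; last exact: cvg_cst.
  rewrite [sphere_val (sphere_of_norm1 _)]/= dotDl dotNl dotZl -zp//.
  have -> : 2 * dot z y - dot z y = dot z y by ring.
  exact: cvg_cst.
have zE : z = 2 *: p - z := congr1 sphere_val (Funiq _ Fr).
suff -> : sphere_val s = p by [].
apply: (@scalerI _ _ (2 : R)); first by rewrite pnatr_eq0.
by rewrite -/z scaler_nat mulr2n {1}zE subrK.
Qed.

End sphere.

(** * Closed linear spans *)

Section span.
Context {R : realType} {H : normedModType R}.
Implicit Type A : set H.

Lemma sub_linear_span A : A `<=` linear_span A.
Proof.
move=> x Ax; exists 1, (fun=> 1), (fun=> x); split=> //.
by rewrite big_ord1 scale1r.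
Qed.

Lemma linear_span_linear A (a : R) x y :
  linear_span A x -> linear_span A y -> linear_span A (a *: x + y).
Proof.
move=> [m [b [u [Au ->]]]] [n [c [v [Av ->]]]].
pose d (i : 'I_(m + n)) := match fintype.split i with inl j => a * b j | inr j => c j end.
pose w (i : 'I_(m + n)) := match fintype.split i with inl j => u j | inr j => v j end.
exists (m + n)%N, d, w; split.
  by move=> i; rewrite /w; case: fintype.split.
rewrite big_split_ord scaler_sumr /=; congr (_ + _); apply: eq_bigr => i _.
  by rewrite scalerA /d /w (unsplitK (inl i : 'I_m + 'I_n)).
by rewrite /d /w (unsplitK (inr i : 'I_m + 'I_n)).
Qed.

(** Joint continuity of (x, y) -> a x + y lets points of the span near [x] and [y] combine into one
    near the target. *)
Lemma closed_span_linear A (a : R) x y :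
  closed_span A x -> closed_span A y -> closed_span A (a *: x + y).
Proof.
move=> Ax Ay B; have : (fun z : H * H => a *: z.1 + z.2) @ (x, y) --> a *: x + y.
  by apply: cvgD; [apply: cvgZr; exact: cvg_fst|exact: cvg_snd].
move=> /[apply] -[[X Y] /= [xX yY] XYB].
have [x' [Ax' Xx']] := Ax _ xX; have [y' [Ay' Yy']] := Ay _ yY.
exists (a *: x' + y'); split; first exact: linear_span_linear.
exact: (XYB (x', y')).
Qed.

Lemma closed_span0 A : closed_span A 0.
Proof.
apply: subset_closure; exists 0, (fun=> 0), (fun=> 0).
by split=> [[]//|]; rewrite big_ord0.
Qed.

Lemma sub_closed_span A : A `<=` closed_span A.
Proof. by apply: subset_trans (@sub_linear_span A) _; exact: subset_closure. Qed.

End span.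

(** * Semicontinuity of the objectives *)

Section objectives.
Context {R : realType} {H : completeNormedModType R}.
Context {hinf : infinite_dimensional H}.
Variable dot : {dot H for idfun}.
Hypothesis dot_norm : forall x : H, `|x| = Num.sqrt (dot x x).
Variable nu : probability (borelType (sphere hinf)) R.

Lemma closure_support_span (x : sphere hinf) :
  closure (Defs.support nu) x -> support_span nu (sphere_val x).
Proof.
have Uclosed : closed (sphere_val @^-1` support_span nu : set (sphere hinf)).
  apply: closed_comp; last exact: closed_closure.
  by move=> y _; exact: sphere_val_continuous.
rewrite -[support_span nu _]/((sphere_val @^-1` support_span nu) x).
rewrite [X in _ -> X x](closure_id _).1//; apply: closure_subset => y nuy.
by apply: sub_closed_span; exists y.
Qed.

(** A general [g] serves both objectives: the identity for [F_infty] and [phi] for [F_phi]. *)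
Lemma cvg_dist_sphere (g : R -> R) (s : nat -> sphere hinf) t x :
  {within `[0, pi], continuous g} ->
  dot (sphere_val (s n)) (sphere_val x) @[n --> \oo] -->
    dot (sphere_val t) (sphere_val x) ->
  g (dist_sphere dot (s n) x) @[n --> \oo] --> g (dist_sphere dot t x).
Proof.
move=> /comp_acos_within_continuous g_cont sx.
apply: (@cvg_within_comp _ _ _ _ _ _ _ _ _ g_cont _ _ sx).
  exact: dot_sphere_itv.
by apply: nearW => n; exact: dot_sphere_itv.
Qed.

(** For each [x], the distances to [x] converge and stay below [F_infty (s n)]; pass to the limit
    before taking the supremum over [x]. *)
Lemma F_infty_weakly_lsc :
  weakly_lower_semicontinuous dot (support_span nu) (F_infty dot nu).
Proof.
move=> s t l st Fl; apply: ge_ereal_sup => _ [x nux <-].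
have id_cont : {within `[0, pi], continuous (@id R)}.
  by apply: continuous_subspaceT => y; exact: cvg_id.
have sx : (dist_sphere dot (s n) x)%:E @[n --> \oo] --> (dist_sphere dot t x)%:E.
  apply: cvg_EFin; first exact: nearW.
  by apply: (cvg_dist_sphere id) => //; apply: st; exact: closure_support_span.
rewrite -(cvg_lim _ Fl)// -(cvg_lim _ sx)//; apply: lee_lim.
- by apply/cvg_ex; eexists; exact: sx.
- by apply/cvg_ex; eexists; exact: Fl.
- by apply: nearW => n; apply: ereal_sup_ubound; exists x.
Qed.

(** [phi] is bounded on the compact [0, pi], and a constant is integrable for the finite measure
    [nu], so dominated convergence applies. *)
Lemma F_phi_weakly_lsc (phi : R -> R) : separable H ->
  {within `[0, pi], continuous phi} ->
  weakly_lower_semicontinuous dot (support_span nu) (F_phi dot nu phi).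
Proof.
move=> Hsep phi_cont s t l st Fl.
have [M phiM] : exists M, forall s x : sphere hinf, `|phi (dist_sphere dot s x)| <= M.
  have /compact_bounded[M [_ phiM]] :
      compact (phi @` `[0, pi]%classic).
    by apply: continuous_compact => //; exact: segment_compact.
  (* Boundedness holds for every number strictly above [M], hence the 1. *)
  exists (M + 1) => s' x; apply: (phiM (M + 1)); first by rewrite ltrDl.
  exists (dist_sphere dot s' x) => //.
  have := dot_sphere_itv _ dot_norm s' x; rewrite /= !in_itv/= => sx.
  by rewrite acos_ge0// acos_lepi.
have phi_meas (s' : sphere hinf) : measurable_fun [set: borelType (sphere hinf)]
    (fun x => (phi (dist_sphere dot s' x))%:E).
  apply/measurable_EFinP; apply: continuous_borel_measurable => x.
  apply: (@cvg_within_comp _ _ _ _ _ (nbhs x)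
    (fun y => dot (sphere_val s') (sphere_val y)) _ _
    (comp_acos_within_continuous _ phi_cont)).
  - exact: dot_sphere_itv.
  - by apply: nearW => y; exact: dot_sphere_itv.
  - apply: (@continuous_comp _ _ _ sphere_val (dot (sphere_val s'))).
      exact: sphere_val_continuous.
    exact: dot_continuous.
have [||_ _ Ft] := @dominated_convergence _ _ _ nu setT measurableT
    (fun n x => (phi (dist_sphere dot (s n) x))%:E) _ (EFin \o cst M)
    (fun n => phi_meas (s n)) (phi_meas t) _
    (finite_measure_integrable_cst nu M measurableT) _.
(* Pairings converge at points of the support only; this is almost everywhere. *)
- apply: negligibleS (negligible_setC_support nu (sphere_second_countable Hsep)).
  apply: subsetC => x nux _; apply: cvg_EFin; first exact: nearW.
  apply: cvg_dist_sphere => //; apply: st.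
  by apply: closure_support_span; exact: subset_closure.
- by apply: aeW => x n _; rewrite lee_fin.
by rewrite -(cvg_lim _ Fl)// (cvg_lim _ Ft).
Qed.

End objectives.

(** * Existence and location of the minimisers *)

Theorem theorem1 (R : realType) (H : completeNormedModType R)
  (dot : {dot H for idfun})
  (dot_norm : forall x : H, `|x| = Num.sqrt (dot x x))
  (hsep : separable H) (hinf : infinite_dimensional H)
  (nu : probability (borelType (sphere hinf)) R)
  (hperp : dim_ge 1%N (orthogonal_complement dot (support_span nu))) :
  [/\ forall phi : R -> R, {within `[0, pi], continuous phi} ->
        (exists s : sphere hinf, minimizer (F_phi dot nu phi) s) /\
        (forall s : sphere hinf, unique (minimizer (F_phi dot nu phi)) s ->
           support_span nu (sphere_val s)),
      forall p : R, 0 < p ->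
        exists s : sphere hinf, minimizer (F_p dot nu p) s
    & (exists s : sphere hinf, minimizer (F_infty dot nu) s) /\
      (forall s : sphere hinf, unique (minimizer (F_infty dot nu)) s ->
         support_span nu (sphere_val s))].
Proof.
have min F : weakly_lower_semicontinuous dot (support_span nu) F ->
    (exists s : sphere hinf, minimizer F s) /\
    (forall s, unique (minimizer F) s -> support_span nu (sphere_val s)).
  move=> Flsc; split; first exact: weakly_lsc_has_minimizer hsep hperp Flsc.
  move=> s; apply: weakly_lsc_unique_minimizer Flsc => //.
  - exact: closed_span0.
  - exact: closed_span_linear.
  - exact: closed_closure.
have F_phi_min phi (phi_cont : {within `[0, pi], continuous phi}) :=
  min _ (F_phi_weakly_lsc dot dot_norm nu phi hsep phi_cont).
split=> //; last exact/min/F_infty_weakly_lsc.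
(* [F_p] is [F_phi] for the power function, by conversion. *)
by move=> p p0; have [] := F_phi_min _ (powR_within_continuous pi p p0).
Qed.
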